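(* For every integer $k\ge 2$ there are positive constants $c_k,C_k,C_k'$ depending only on $k$ such that $P_k(n,\epsilon,3)\ge c_k\epsilon^{-k}$ whenever $C_k' n^{-1/2}\le \epsilon\le C_k$.
   Context: A hypergraph is $k$-uniform if each edge has exactly $k$ vertices. A (tight) path of length $\ell$ in a $k$-uniform hypergraph consists of $\ell+k-1$ vertices $v_1,\dots,v_{\ell+k-1}$ and the $\ell$ edges $\{v_i,\dots,v_{i+k-1}\}$, $1\le i\le \ell$, all of which are edges; its endpoints are $v_1,v_{\ell+k-1}$. The distance between two vertices is the length of a shortest tight path with those endpoints ($\infty$ if none), and the diameter is the maximum distance between two vertices. The diameter of an edge set $E'$ is that of the hypergraph with edge set $E'$ on the vertices covered by $E'$. $P_k(n,\epsilon,d)$ is the smallest $\ell$ such that every $k$-uniform hypergraph $G=(V,E)$ on $n$ vertices has an edge partition $E=E_0\cup E_1\cup\cdots\cup E_\ell$ with $|E_0|\le\epsilon n^k$ and each $E_i$ ($1\le i\le\ell$) of diameter at most $d$. *)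

(* Defs.v *)
From HB Require Import structures.
From mathcomp Require Import boolp classical_sets reals constructive_ereal ereal.
From mathcomp Require Import all_boot all_order all_algebra.

Set Implicit Arguments.
Unset Strict Implicit.
Unset Printing Implicit Defensive.

Import Order.TTheory GRing.Theory Num.Theory.

Local Open Scope ring_scope.

(** A hypergraph on a finite vertex type [V] is given by its edge set
    [E : {set {set V}}]. *)
Definition uniform (V : finType) (k : nat) (E : {set {set V}}) : Prop :=
  forall e, e \in E -> #|e| = k.

(** [x :: q] lists the vertices v_1, ..., v_(l+k-1), which are distinct.
    We require [0 < l]: the degenerate paths of length 0 have k - 1 vertices
    and no edge, so for k >= 3 they would join any two vertices. *)
Definition tight_path (V : finType) (k : nat) (E : {set {set V}}) (l : nat)
    (x y : V) : Prop :=
  exists q : seq V,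
    [/\ (0 < l)%N, size (x :: q) = (l + k - 1)%N, uniq (x :: q), last x q = y
      & forall i, (i < l)%N -> [set z in take k (drop i (x :: q))]%SET \in E].

(** The distance is [+oo] when no tight path joins two distinct vertices. *)
Definition dist (R : realType) (V : finType) (k : nat) (E : {set {set V}})
    (x y : V) : \bar R :=
  if x == y then 0%E
  else ereal_inf [set l%:R%:E | l in [set l | tight_path k E l x y]]%classic.

(** Only the vertices covered by [E] count.  The empty edge set gets
    diameter [-oo]. *)
Definition diam (R : realType) (V : finType) (k : nat) (E : {set {set V}}) :
    \bar R :=
  ereal_sup
    [set z | exists x y, [/\ x \in cover E, y \in cover E
                           & z = dist R k E x y]]%classic.

(** The parts are allowed to be empty. *)
Definition decomposition (R : realType) (V : finType) (k : nat) (eps : R)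
    (d l : nat) (E : {set {set V}}) (F : 'I_l.+1 -> {set {set V}}) : Prop :=
  [/\ (\bigcup_i F i)%SET = E,
      forall i j, i != j -> [disjoint F i & F j],
      #|F ord0|%:R <= eps * #|V|%:R ^+ k
    & forall i, i != ord0 -> (diam R k (F i) <= d%:R%:E)%E].

Definition decomposable (R : realType) (k n : nat) (eps : R) (d l : nat) :
    Prop :=
  forall E : {set {set 'I_n}}, uniform k E ->
    exists F : 'I_l.+1 -> {set {set 'I_n}}, decomposition k eps d E F.

Lemma decomposable_asbool (R : realType) (k n : nat) (eps : R) (d : nat) :
  (exists l, decomposable k n eps d l) ->
  exists l, `[< decomposable k n eps d l >].
Proof. by case=> l h; exists l; apply/asboolP. Qed.

(** P_k(n, eps, d).  The default value 0 is not reached when [0 <= eps] and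
    [0 < d], see [P_spec]. *)
Definition P (R : realType) (k n : nat) (eps : R) (d : nat) : nat :=
  if pselect (exists l, decomposable k n eps d l) is left h
  then ex_minn (decomposable_asbool h) else 0%N.

Lemma tight_path_edge (V : finType) (e : {set V}) (x y : V) :
  x \in e -> y \in e -> x != y -> tight_path #|e| [set e]%SET 1 x y.
Proof.
move=> xe ye xy; have yx : y \in (e :\ x)%SET by rewrite !inE eq_sym xy.
set s := enum ((e :\ x) :\ y)%SET.
have us : uniq (x :: rcons s y).
  rewrite /= rcons_uniq mem_rcons inE negb_or xy !mem_enum enum_uniq.
  by rewrite !inE !eqxx !andbF.
have ms : x :: rcons s y =i e.
  move=> z; rewrite inE mem_rcons inE mem_enum !inE.
  by case: (eqVneq z x) => [->|] //=; case: (eqVneq z y) => [->|].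
have ss : size (x :: rcons s y) = #|e|.
  by rewrite -(eq_card ms); apply/esym/card_uniqP.
exists (rcons s y); split => //.
- by rewrite ss addKn.
- by rewrite last_rcons.
move=> i; rewrite ltnS leqn0 => /eqP ->; rewrite drop0 -ss take_size inE.
by apply/eqP/setP => z; rewrite inE ms.
Qed.

Lemma diam_leP (R : realType) (V : finType) (k : nat) (E : {set {set V}})
    (d : nat) :
  (diam R k E <= d%:R%:E)%E <->
  forall x y, x \in cover E -> y \in cover E -> x != y ->
    exists2 l, (l <= d)%N & tight_path k E l x y.
Proof.
split=> [h x y xE yE xy|h].
  have : (dist R k E x y <= d%:R%:E)%E.
    by apply: le_trans h; apply: ereal_sup_ubound; exists x, y.
  rewrite /dist (negbTE xy) => hd; apply: contrapT => hn.
  suff : (d.+1%:R%:E <= d%:R%:E :> \bar R)%E by rewrite lee_fin ler_nat ltnn.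
  apply: le_trans hd; apply: le_ereal_inf_tmp => _ /= [l hl <-].
  rewrite lee_fin ler_nat ltnNge; apply/negP => ld.
  by apply: hn; exists l.
apply: ge_ereal_sup => _ /= [x [y [xE yE ->]]]; rewrite /dist.
have [_|xy] := eqVneq x y; first by rewrite lee_fin.
have [l ld hl] := h x y xE yE xy.
apply: (@le_trans _ _ (l%:R%:E)); last by rewrite lee_fin ler_nat.
by apply: ereal_inf_lbound; exists l.
Qed.

Lemma decomposable_exists (R : realType) (k n : nat) (eps : R) (d : nat) :
  0 <= eps -> (0 < d)%N -> exists l, decomposable k n eps d l.
Proof.
move=> eps0 d0; exists #|{set 'I_n}| => E Ek.
pose F (i : 'I_#|{set 'I_n}|.+1) : {set {set 'I_n}} :=
  [set e in E | lift ord0 (enum_rank e) == i]%SET.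
exists F; split.
- apply/setP => e; apply/bigcupP/idP => [[i _]|eE].
    by rewrite inE => /andP[].
  by exists (lift ord0 (enum_rank e)); rewrite // inE eE eqxx.
- move=> i j ij; rewrite -setI_eq0; apply/eqP/setP => e; rewrite !inE.
  by apply/negP => /andP[/andP[_ /eqP ei] /andP[_ /eqP ej]];
    rewrite -ei -ej eqxx in ij.
- rewrite [F ord0](_ : _ = set0) ?cards0 ?mulr_ge0 ?exprn_ge0 ?ler0n //.
  by apply/setP => e; rewrite !inE andbC; case: eqP.
move=> i _; apply/diam_leP => x y /bigcupP[e eF xe] /bigcupP[e' e'F ye'] xy.
have Fe (f : {set 'I_n}) : f \in F i -> f = e.
  move: eF; rewrite !inE => /andP[_ /eqP <-] /andP[_ /eqP].
  by move=> /lift_inj /enum_rank_inj.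
have -> : F i = [set e]%SET.
  by apply/setP => f; rewrite [RHS]inE; apply/idP/eqP => [/Fe|->].
have <- : #|e| = k by apply: Ek; move: eF; rewrite inE => /andP[].
by exists 1%N => //; apply: tight_path_edge => //; rewrite -(Fe _ e'F).
Qed.

Lemma P_spec (R : realType) (k n : nat) (eps : R) (d : nat) :
  0 <= eps -> (0 < d)%N ->
  decomposable k n eps d (P k n eps d) /\
  forall l, decomposable k n eps d l -> (P k n eps d <= l)%N.
Proof.
move=> eps0 d0; rewrite /P; case: pselect => [h|]; last first.
  by move/(_ (decomposable_exists k n eps0 d0)).
case: ex_minnP => m /asboolP hm mle; split=> // l hl.
by apply: mle; apply/asboolP.
Qed.

(* Main.v *)
(** A tight path of length at most 3 joining two vertices of the same class of a
    k-partite k-uniform hypergraph has length 2, so it consists of two edges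
    that differ in one vertex only.  Hence the edge sets of diameter at most 3
    are "closed": any two vertices of the same class that they cover extend to
    two edges agreeing off that class.

    Take q = 2^j of order 1/eps and let each class be the q^2 pairs (g, x) over
    a group of order q; k pairs form an edge when the sum of the x equals c(g)
    for a function c of the k-tuple g.  This hypergraph has q^(2k-1) edges, and
    in a closed set of edges x is a function of g in each class.  It remains to
    choose c such that closed sets have O(q^(k-1)) edges; then q^k parts are
    needed, and blowing up each vertex transfers this bound to all large n.

    For k >= 3 a random c works, by a union bound over the q^(kq) k-tuples of
    functions.  For k = 2 that union bound loses a logarithm, so take
    c(g, g') = g g', which gives the incidences of an affine plane.  A closed set
    then consists of all incidences between a set of points and a set of lines
    such that two points are joined by a line and two lines meet.  It is either
    degenerate, hence small, or regular.  Keeping one colour class of a random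
    2-colouring of the incidences destroys all regular configurations of degree
    at least a constant times log q, and those of smaller degree are small. *)

Require Import Defs.
From mathcomp Require Import all_boot all_order all_algebra.
From mathcomp Require Import reals.
From mathcomp Require Import constructive_ereal finfield zify ring lra.

Set Implicit Arguments.
Unset Strict Implicit.
Unset Printing Implicit Defensive.

Import Order.TTheory GRing.Theory Num.Theory.

(** * Closed families of edges *)

(** An edge of a k-partite hypergraph whose classes are copies of [U] is encoded by the function
    choosing its vertex in each class; [w] and [w'] serve to say that [w j] and [w' j] are
    covered. *)
Definition closed_family (k : nat) (U : finType) (F : {set {ffun 'I_k -> U}}) :=
  forall w w' j, w \in F -> w' \in F ->
    exists v v', [/\ v \in F, v' \in F, v j = w j, v' j = w' j
                   & forall i, i != j -> v i = v' i].

Section Transversal.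
Variables (k : nat) (U V : finType) (io : 'I_k * U -> V).
Hypothesis io_inj : injective io.

Definition edge (w : {ffun 'I_k -> U}) : {set V} := [set io (j, w j) | j : 'I_k].

Lemma mem_edge w j u : (io (j, u) \in edge w) = (w j == u).
Proof.
apply/imsetP/eqP => [[i _ /io_inj[-> ->]] //|<-]; by exists j.
Qed.

Lemma card_edge w : #|edge w| = k.
Proof. by rewrite card_imset ?card_ord // => i j /io_inj[]. Qed.

Lemma edge_inj : injective edge.
Proof.
move=> w w' eww'; apply/ffunP => j; apply/eqP.
by rewrite -mem_edge eww' mem_edge.
Qed.

(** Length 1 would put two vertices of class [j] in one edge. In a path of length 3 every vertex of
    the middle edge lies in an outer edge, whose only vertex of class [j] is an endpoint of the
    path; so the middle edge would miss class [j]. The two edges of a path of length 2 differ only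
    in the endpoints. *)
Lemma diam3_closed (A : {set {ffun 'I_k -> U}}) (F : {set {set V}}) :
  (1 < k)%N -> F \subset edge @: A ->
  (forall x y, x \in cover F -> y \in cover F -> x != y ->
    exists2 l, (l <= 3)%N & tight_path k F l x y) ->
  closed_family [set w in A | edge w \in F].
Proof.
move=> k1 FA dF w w' j; rewrite !inE => /andP[wA wF] /andP[w'A w'F].
have FE (e : {set V}) : e \in F -> exists2 v, v \in A & e = edge v.
  by move=> eF; have /imsetP[v vA ->] := subsetP FA _ eF; exists v.
have [eqj|neqj] := eqVneq (w j) (w' j).
  by exists w, w; rewrite !inE wA wF.
set x := io (j, w j); set y := io (j, w' j).
have xw : x \in edge w by rewrite mem_edge.
have yw : y \in edge w' by rewrite mem_edge.
have xy : x != y by apply: contraNneq neqj => /io_inj[->].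
have notboth v : x \in edge v -> y \in edge v -> False.
  by rewrite !mem_edge => /eqP vw /eqP vw'; rewrite -vw -vw' eqxx in neqj.
have [||l l3 [q [l0 sq uq lq wq]]] := dF x y _ _ xy.
- by apply/bigcupP; exists (edge w).
- by apply/bigcupP; exists (edge w').
have xq := mem_head x q.
have yq : y \in x :: q by rewrite -lq mem_last.
case: l l0 l3 sq wq => [//|[|[|[|//]]]] _ _ sq wq.
- have := wq 0%N isT; rewrite drop0 take_oversize ?sq ?addKn // => /FE[v vA ev].
  by case: (notboth v); rewrite -ev inE.
- case/lastP: q lq sq uq wq {xq yq} => [/eqP|W z]; first by rewrite (negPf xy).
  rewrite last_rcons => zy; rewrite {z}zy /= size_rcons => sq uq wq.
  have sW : size W = k.-1 by clear -k1 sq; lia.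
  have := wq 0%N isT; rewrite drop0 -rcons_cons -cats1 take_size_cat; last first.
    by rewrite /= sW prednK // ltnW.
  move=> e0F; have [v vA ev] := FE _ e0F.
  have := wq 1%N isT; rewrite /= drop0 take_oversize ?size_rcons; last first.
    by rewrite sW prednK // ltnW.
  move=> e1F; have [v' v'A ev'] := FE _ e1F.
  exists v, v'; rewrite !inE -ev -ev' vA v'A e0F e1F; split=> //.
  + by apply/eqP; rewrite -mem_edge -ev inE mem_head.
  + by apply/eqP; rewrite -mem_edge -ev' inE mem_rcons mem_head.
  move=> i ij; apply/esym/eqP; rewrite -mem_edge -ev' inE mem_rcons inE.
  have : io (i, v i) \in edge v by rewrite mem_edge.
  rewrite -ev inE inE => /orP[/eqP/io_inj[ij' _]|->]; last by rewrite orbT.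
  by rewrite ij' eqxx in ij.
(* Length 3: the vertices are x, a, W, b, y in order, with [W] of size k - 2. *)
case: q lq sq uq wq {xq yq} => [/eqP|a q]; first by rewrite (negPf xy).
case/lastP: q => [|q z]; first by move=> _ sq; move: k1 sq; clear => /=; lia.
rewrite /= last_rcons => zy; rewrite {z}zy.
case/lastP: q => [|W b]; first by move=> sq; move: k1 sq; clear => /=; lia.
rewrite !size_rcons => sq uq wq.
have sW : (size W).+2 = k by move: k1 sq; clear; lia.
have := wq 0%N isT; rewrite drop0 -!cats1 -!catA -!cat_cons take_size_cat; last first.
  by rewrite /= sW.
move=> /FE[v0 _ ev0].
have := wq 1%N isT; rewrite [drop _ _]/= -cats1 -cat_cons take_size_cat; last first.
  by rewrite /= size_rcons sW.
move=> /FE[v1 _ ev1].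
have := wq 2%N isT; rewrite [drop _ _]/= drop0 take_oversize; last first.
  by rewrite !size_rcons sW.
move=> /FE[v2 _ ev2].
have v0j : v0 j = w j by apply/eqP; rewrite -mem_edge -ev0 inE mem_head.
have v2j : v2 j = w' j.
  by apply/eqP; rewrite -mem_edge -ev2 inE mem_rcons mem_head.
have : io (j, v1 j) \in edge v1 by rewrite mem_edge.
move: uq; rewrite /= !(inE, mem_rcons) !negb_or.
move=> /and3P[/and4P[xa _ xb xW] /andP[ay _]].
rewrite !rcons_uniq !(inE, mem_rcons) !negb_or => /andP[/andP[yb yW] _].
rewrite -ev1 !(inE, mem_rcons) => v1E.
have : (io (j, v1 j) \in edge v0) || (io (j, v1 j) \in edge v2).
  rewrite -ev0 -ev2 !(inE, mem_rcons).
  by case/or3P: v1E => ->; rewrite ?orbT.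
rewrite !mem_edge v0j v2j => /orP[] /eqP E; rewrite -E -/x -/y in v1E.
- by rewrite (negPf xa) (negPf xb) (negPf xW) in v1E.
- by rewrite (eq_sym y a) (negPf ay) (negPf yb) (negPf yW) in v1E.
Qed.

End Transversal.

(** * Sums prescribed by a random function *)

(** A Bernoulli-type inequality, (1 + 1/q)^m (1 - m/q) <= 1, cleared of denominators. With q = 2m it
    gives (1 + 1/q)^m <= 2, the estimate behind both union bounds. *)
Lemma expSn_mul_subn_le q m : (m <= q -> q.+1 ^ m * (q - m) <= q ^ m.+1)%N.
Proof.
elim: m => [|m IHm] mq; first by rewrite expn0 mul1n subn0 expn1.
have step : (q.+1 * (q - m.+1) <= q * (q - m))%N by clear IHm; nia.
rewrite expnSr -mulnA (leq_trans (leq_mul (leqnn _) step)) //.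
by rewrite mulnCA expnS leq_mul ?IHm // ltnW.
Qed.

Lemma expSn_double_le h : ((2 * h).+1 ^ h <= 2 * (2 * h) ^ h)%N.
Proof.
case: h => // h; set m := h.+1.
have := @expSn_mul_subn_le (2 * m) m; rewrite leq_pmull // => /(_ isT).
rewrite {2}mul2n -addnn addnK expnS -mulnA mulnCA mulnC => H.
by rewrite -(@leq_pmul2l m) // (leq_trans H) // mulnA (mulnC 2%N).
Qed.

(** First moment with the weight 2^(number of agreements): for fixed [s] its sum over all [c]
    factors over [I], each factor being (#|Q| - 1) + 2. If every [c] had an [s] with at least [x]
    agreements, the total over [s] would be at least 2^x #|Q|^#|I|. *)
Lemma exists_few_agreements (I S Q : finType) (f : S -> I -> Q) (x : nat) :
  (#|S| * #|Q|.+1 ^ #|I| < 2 ^ x * #|Q| ^ #|I|)%N ->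
  exists c : {ffun I -> Q}, forall s, (#|[set i | f s i == c i]| < x)%N.
Proof.
move=> lt_x.
suff /existsP[c /forallP cP] : [exists c : {ffun I -> Q},
    [forall s, #|[set i | f s i == c i]| < x]%N] by exists c.
apply: contraLR lt_x => /existsPn many.
have {}many (c : {ffun I -> Q}) : exists s, (x <= #|[set i | f s i == c i]|)%N.
  by have /forallPn[s sx] := many c; exists s; rewrite leqNgt.
have gen s : (\sum_(c : {ffun I -> Q}) 2 ^ #|[set i | f s i == c i]|
              = #|Q|.+1 ^ #|I|)%N.
  transitivity (\sum_(c : {ffun I -> Q}) \prod_i (if f s i == c i then 2 else 1))%N.
    apply: eq_bigr => c _; rewrite -big_mkcond /= prod_nat_const.
    by congr (2 ^ _)%N; apply: eq_card => i; rewrite inE.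
  rewrite -(bigA_distr_bigA (fun i a => if f s i == a then 2 else 1))%N.
  under eq_bigr => i _.
    rewrite (eq_bigr (fun a => 1 + (f s i == a)))%N; last by move=> a _; case: eqP.
    rewrite big_split /= sum1_card.
    rewrite (bigD1 (f s i)) //= eqxx big1 ?addn0; last first.
      by move=> a; rewrite eq_sym => /negPf ->.
    rewrite addn1; over.
  by rewrite prod_nat_const.
rewrite -leqNgt -card_ffun mulnC -sum_nat_const.
rewrite -(sum_nat_const S) -(eq_bigr _ (fun s _ => gen s)) exchange_big /=.
apply: leq_sum => c _; have [s sx] := many c.
by rewrite (bigD1 s) //= (leq_trans _ (leq_addr _ _)) // leq_exp2l.
Qed.

Section Shift.
Local Open Scope ring_scope.
Variables (k : nat) (Q : finZmodType).
Implicit Types (c : {ffun {ffun 'I_k -> Q} -> Q}) (w : {ffun 'I_k -> Q * Q}).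

Definition base w : {ffun 'I_k -> Q} := [ffun j => (w j).1].

Definition shift_family c :=
  [set w : {ffun 'I_k -> Q * Q} | \sum_j (w j).2 == c (base w)].

(** Overwriting x in one class enforces the equation, and the overwritten value recovers the
    original tuple. *)
Lemma card_shift_family c : (0 < k)%N ->
  (#|Q| ^ (2 * k) <= #|shift_family c| * #|Q|)%N.
Proof.
move=> k0; pose j0 := Ordinal k0.
pose norm w : {ffun 'I_k -> Q * Q} := [ffun j => ((w j).1,
  if j == j0 then c (base w) - \sum_(i | i != j0) (w i).2 else (w j).2)].
have base_norm w : base (norm w) = base w by apply/ffunP => j; rewrite !ffunE.
have norm_in w : norm w \in shift_family c.
  rewrite inE base_norm (bigD1 j0) //= ffunE eqxx /= [X in _ + X](_ : _ =
    \sum_(i | i != j0) (w i).2) ?subrK //.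
  by apply: eq_bigr => i /negPf ij; rewrite ffunE ij.
pose f w := (norm w, (w j0).2).
have f_inj : injective f.
  move=> w w' [/ffunP nn w0]; apply/ffunP => j.
  have := nn j; rewrite !ffunE => -[e1 e2].
  suff e3 : (w j).2 = (w' j).2.
    by rewrite [LHS]surjective_pairing e1 e3 -surjective_pairing.
  by move: e2; case: (eqVneq j j0) => [->|].
have := card_imset predT f_inj; rewrite cardT -cardE card_ffun card_ord card_prod.
rewrite mulnn -expnM => <-; rewrite -cardsT -cardsX; apply: subset_leq_card.
apply/subsetP => _ /imsetP[w _ ->]; rewrite in_setX in_setT andbT.
exact: norm_in.
Qed.

(** The two edges given by closedness agree off class [j]. If their g agree in class [j] too, both
    sums equal the same value of [c], so their x agree there. *)
Lemma closed_shift_transversal c (F : {set {ffun 'I_k -> Q * Q}}) :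
  F \subset shift_family c -> closed_family F ->
  forall w w' j, w \in F -> w' \in F -> (w j).1 = (w' j).1 -> w j = w' j.
Proof.
move=> /subsetP FA cF w w' j wF w'F e1.
have [v [v' [/FA vA /FA v'A vj v'j vv']]] := cF w w' j wF w'F.
have bv : base v = base v'.
  apply/ffunP => i; rewrite !ffunE; case: (eqVneq i j) => [->|/vv' -> //].
  by rewrite vj v'j.
move: vA v'A; rewrite !inE bv => /eqP <-.
rewrite (bigD1 j) //= [X in _ == X](bigD1 j) //= vj v'j.
rewrite [X in _ + X == _](eq_bigr (fun i => (v i).2)); last first.
  by move=> i /vv' ->.
by move=> /eqP/addIr e2; rewrite [w j]surjective_pairing e1 -e2 -surjective_pairing.
Qed.

(** On [F] the second coordinate is a function [s] of the class and the first coordinate, so [base]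
    injects [F] into the places where [c] agrees with the sum of [s]. *)
Lemma card_closed_shift c (F : {set {ffun 'I_k -> Q * Q}}) :
  F \subset shift_family c -> closed_family F ->
  exists s : {ffun 'I_k * Q -> Q},
    (#|F| <= #|[set g : {ffun 'I_k -> Q} | (\sum_j s (j, g j))%R == c g]|)%N.
Proof.
move=> FA cF; have tr := closed_shift_transversal FA cF.
(* The default 0 is taken at pairs that [F] does not cover. *)
pose s : {ffun 'I_k * Q -> Q} := [ffun p =>
  if [pick w in F | (w p.1).1 == p.2] is Some w then (w p.1).2 else 0].
have sE w j : w \in F -> s (j, (w j).1) = (w j).2.
  move=> wF; rewrite ffunE /=; case: pickP => [w' /andP[w'F /eqP e1]|/(_ w)].
    by rewrite (tr w' w j).
  by rewrite wF eqxx.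
exists s; rewrite -(@card_in_imset _ _ base F).
  apply: subset_leq_card; apply/subsetP => _ /imsetP[w wF ->].
  rewrite inE; have := subsetP FA _ wF; rewrite inE => /eqP <-; apply/eqP.
  by apply: eq_bigr => j _; rewrite [base w j]ffunE sE.
move=> w w' wF w'F bw; apply/ffunP => j; apply: (tr) => //.
by have := congr1 (fun f : {ffun _ -> _} => f j) bw; rewrite !ffunE.
Qed.

End Shift.

(** In the exponent (k + 2) q^(k-1), the part k q^(k-1) pays for the q^(kq) choices of [s], as q^q <
    2^(q^2) and k >= 3; the part 2 q^(k-1) pays for (1 + 1/q)^(q^k) <= 4^(q^(k-1)). Evenness of q
    serves the latter bound. *)
Lemma exists_shift_family_ge3 k (Q : finZmodType) h :
  (2 < k)%N -> (0 < h)%N -> #|Q| = (2 * h)%N ->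
  exists c : {ffun {ffun 'I_k -> Q} -> Q},
    forall F : {set {ffun 'I_k -> Q * Q}},
      F \subset shift_family c -> closed_family F ->
      (#|F| <= (k + 2) * #|Q| ^ (k - 1))%N.
Proof.
move=> k3 h0 qh; set q := #|Q|.
pose f (s : {ffun 'I_k * Q -> Q}) (g : {ffun 'I_k -> Q}) := (\sum_j s (j, g j))%R.
have [|c cP] := @exists_few_agreements _ _ _ f ((k + 2) * q ^ (k - 1))%N; last first.
  exists c => F FA cF; have [s sP] := card_closed_shift FA cF.
  by rewrite ltnW // (leq_ltn_trans sP) ?cP.
rewrite !card_ffun card_prod card_ord -/q.
have q2 : (q.+1 ^ q <= 4 * q ^ q)%N.
  rewrite {2 4}/q qh mul2n -addnn !expnD -[4%N]/(2 * 2)%N mulnACA.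
  by rewrite leq_mul // /q qh expSn_double_le.
have ek : (q ^ k = q * q ^ (k - 1))%N by rewrite -expnS -subSn ?subSS ?subn0 // ltnW // ltnW.
have q0 : (0 < q)%N by rewrite /q qh muln_gt0.
have lt1 : (q ^ (k * q) < 2 ^ (k * q ^ (k - 1)))%N.
  have : (q ^ q < 2 ^ (q ^ (k - 1)))%N.
    apply: (@leq_trans ((2 ^ q) ^ q)).
      by rewrite ltn_exp2r // ltn_expl.
    rewrite -expnM mulnn leq_exp2l // leq_pexp2l //; first by clear -k3; lia.
  rewrite [(k * q)%N]mulnC [(k * _)%N]mulnC !expnM => lt.
  by rewrite ltn_exp2r //; clear -k3; lia.
have le2 : (q.+1 ^ (q ^ k) <= 2 ^ (2 * q ^ (k - 1)) * q ^ (q ^ k))%N.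
  by rewrite !ek !(expnM _ q) (expnM 2) -expnMn leq_exp2r // expn_gt0 q0.
rewrite mulnDl expnD -mulnA (leq_ltn_trans (leq_mul (leqnn _) le2)) //.
by rewrite ltn_pmul2r // muln_gt0 !expn_gt0 q0.
Qed.

(** * Closed configurations of points and lines *)

Lemma leq_card_rel (X Y : finType) (A : {set X}) (B : {set Y}) (r : X -> Y -> bool) :
  (forall x, x \in A -> exists2 y, y \in B & r x y) ->
  (forall x x' y, x \in A -> x' \in A -> y \in B -> r x y -> r x' y -> x = x') ->
  #|A| <= #|B|.
Proof.
move=> ex inj; pose f x := [pick y in B | r x y].
have fP x : x \in A -> exists2 y, (y \in B) && r x y & f x = Some y.
  move=> /ex[y yB xy]; rewrite /f; case: pickP => [z zP|/(_ y)]; first by exists z.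
  by rewrite yB xy.
have f_inj : {in A &, injective f}.
  move=> x x' xA x'A; have [y /andP[yB xy] ->] := fP x xA.
  by have [y' /andP[_ xy'] ->] := fP x' x'A => -[yy'];
    apply: (inj x x' y) => //; rewrite yy'.
rewrite -(card_in_imset f_inj) -(card_imset _ (@Some_inj _ : injective (@Some Y))).
apply: subset_leq_card; apply/subsetP => _ /imsetP[x xA ->].
by have [y /andP[yB _] ->] := fP x xA; apply: imset_f.
Qed.

Definition deg (P L : finType) (i : P -> L -> bool) p := #|[set l | i p l]|.
Definition pts (P L : finType) (i : P -> L -> bool) := [set p | [exists l, i p l]].
Definition flags (P L : finType) (i : P -> L -> bool) := [set z | i z.1 z.2].

(** Only points and lines on some flag are constrained, and these form a projective plane, possibly
    degenerate. *)
Definition plane (P L : finType) (i : P -> L -> bool) :=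
  [/\ forall p l p' l', i p l -> i p' l' -> exists2 m, i p m & i p' m,
      forall p l p' l', i p l -> i p' l' -> exists2 x, i x l & i x l'
    & forall p p' l l', i p l -> i p l' -> i p' l -> i p' l' -> p = p' \/ l = l'].

Local Notation dual i := (fun l p => i p l).

Lemma plane_dual (P L : finType) (i : P -> L -> bool) : plane i -> plane (dual i).
Proof.
case=> jn mt lin; split=> [l p l' p' a b|l p l' p' a b|l l' p p' a b c d].
- by have [x] := mt _ _ _ _ a b; exists x.
- by have [x] := jn _ _ _ _ a b; exists x.
- by case: (lin _ _ _ _ a c b d); [right|left].
Qed.

Lemma card_flags (P L : finType) (i : P -> L -> bool) :
  #|flags i| = \sum_(p in pts i) deg i p.
Proof.
transitivity (\sum_p deg i p).
  rewrite -sum1dep_card (eq_bigr (fun p => \sum_(l | i p l) 1)); last first.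
    by move=> p _; rewrite sum1dep_card.
  by rewrite pair_big_dep.
rewrite (bigID (mem (pts i))) /= [X in _ + X]big1 ?addn0 // => p.
rewrite inE negb_exists => /forallP no; apply/eqP; rewrite cards_eq0.
by apply/eqP/setP => l; rewrite !inE (negPf (no l)).
Qed.

Lemma card_flags_dual (P L : finType) (i : P -> L -> bool) :
  #|flags (dual i)| = #|flags i|.
Proof.
have sw_inj : injective (fun z : P * L => (z.2, z.1)) by move=> [a b] [a' b'] [-> ->].
rewrite -(card_imset (mem (flags i)) sw_inj); apply: eq_card => -[l p].
apply/idP/imsetP => [|[[p' l']]]; rewrite !inE /= => H; first by exists (p, l); rewrite ?inE.
by case=> -> ->.
Qed.

Lemma mem_pts (P L : finType) (i : P -> L -> bool) p l : i p l -> p \in pts i.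
Proof. by move=> pl; rewrite inE; apply/existsP; exists l. Qed.

Section Plane.
Variables (P L : finType) (i : P -> L -> bool).
Hypothesis ip : plane i.

Lemma plane_join p p' : p \in pts i -> p' \in pts i -> exists2 m, i p m & i p' m.
Proof. by case: ip => jn _ _; rewrite !inE => /existsP[l pl] /existsP[l']; apply: jn pl. Qed.

Lemma plane_line p p' : p \in pts i -> p' \in pts i -> p != p' ->
  exists m, forall l, i p l -> i p' l -> l = m.
Proof.
move=> pS p'S pp'; case: ip => _ _ lin; have [m pm p'm] := plane_join pS p'S.
exists m => l pl p'l; case: (lin _ _ _ _ pl pm p'l p'm) => // /eqP.
by rewrite (negPf pp').
Qed.

(** Joining [p] to the points of [l] gives distinct lines: a line meeting [l] twice is [l], which
    misses [p]. *)
Lemma leq_deg p l : p \in pts i -> ~~ i p l -> deg (dual i) l <= deg i p.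
Proof.
move=> pS npl; case: (ip) => _ _ lin.
apply: (@leq_card_rel _ _ _ _ i) => [x|x x' m]; rewrite !inE => xl.
  have [m pm xm] := plane_join pS (mem_pts xl).
  by exists m; rewrite ?inE.
move=> x'l pm xm x'm; case: (lin _ _ _ _ xl xm x'l x'm) => // lm.
by rewrite lm pm in npl.
Qed.

(** All points lie on the at most [D] lines through [p]. *)
Lemma leq_card_pts D p : (forall l, deg (dual i) l <= D) -> deg i p <= D ->
  p \in pts i -> #|pts i| <= D * D.
Proof.
move=> degl degp pS.
apply: (@leq_trans (\sum_(m | i p m) deg (dual i) m)); last first.
  apply: leq_trans (leq_sum _ (fun m _ => degl m)) _.
  by rewrite sum_nat_const leq_mul2r -[#|_|]cardsE degp orbT.
rewrite -sum1_card; apply: (@leq_trans (\sum_(x in pts i) \sum_(m | i p m) i x m)).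
  apply: leq_sum => x xS; have [m pm xm] := plane_join pS xS.
  by rewrite (bigD1 m) //= xm.
rewrite exchange_big /=; apply: leq_sum => m _.
rewrite /deg -sum1_card big_mkcond [leqRHS]big_mkcond /=.
apply: leq_sum => x _; rewrite inE; case: (x \in pts i) => //.
Qed.

End Plane.

Lemma eq_deg (P L : finType) (i : P -> L -> bool) p l : plane i ->
  p \in pts i -> l \in pts (dual i) -> ~~ i p l -> deg (dual i) l = deg i p.
Proof.
move=> ip pS lT npl; apply/eqP; rewrite eqn_leq (leq_deg ip) //.
exact: (leq_deg (plane_dual ip)).
Qed.

(** With at most one point off [l], every other line has at most two points. With two points off
    [l], all points and all lines but possibly one turn out to have degree [d], so the lines
    outnumber the points by at most one and d > 4c contradicts the sparsity hypothesis. *)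
Lemma long_line_flags (P L : finType) (i : P -> L -> bool) l c :
  plane i -> 0 < c -> #|flags i| <= c * (#|pts i| + #|pts (dual i)|) ->
  4 * c < deg (dual i) l ->
  #|flags i| <= #|pts i| + 2 * #|pts (dual i)|.
Proof.
move=> ip c0 le_c; set d := deg (dual i) l => big.
have dpl := plane_dual ip.
have lT : l \in pts (dual i).
  have /card_gt0P[p] : 0 < d by apply: leq_trans big.
  by rewrite inE; apply: (@mem_pts _ _ (dual i)).
set off := [set p in pts i | ~~ i p l].
have [off1|] := leqP #|off| 1.
  rewrite -card_flags_dual card_flags (bigD1 l) //=; apply: leq_add.
    by apply: subset_leq_card; apply/subsetP => p; rewrite inE => /mem_pts.
  apply: (@leq_trans (\sum_(m in pts (dual i) | m != l) 2)); last first.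
    rewrite sum_nat_cond_const mulnC leq_mul //; apply: subset_leq_card.
    by apply/subsetP => m; rewrite inE => /andP[].
  apply: leq_sum => m /andP[_ ml]; rewrite /deg -(cardsID [set p | i p l]).
  apply: (@leq_add _ _ 1 1); last first.
    apply: leq_trans off1; apply: subset_leq_card; apply/subsetP => p.
    by rewrite !inE => /andP[-> /mem_pts]; rewrite inE => ->.
  apply/card_le1_eqP => p p'; rewrite !inE => /andP[pm pl] /andP[p'm p'l].
  by case: ip => _ _ lin; case: (lin _ _ _ _ pm pl p'm p'l) => // /eqP; rewrite (negPf ml).
move=> /card_gt1P[p [p' [+ + pp']]]; rewrite !inE => /andP[pS npl] /andP[p'S np'l].
have pS' : p \in pts i by rewrite inE.
have p'S' : p' \in pts i by rewrite inE.
have dp := eq_deg ip pS' lT npl.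
have dp' := eq_deg ip p'S' lT np'l.
have [b bP] := plane_line ip pS' p'S' pp'.
(* A line other than [b], the line joining [p] and [p'], misses [p] or [p']. *)
have degl m : m \in pts (dual i) -> m != b -> deg (dual i) m = d.
  move=> mT mb; have [pm|npm] := boolP (i p m); last by rewrite (eq_deg ip pS').
  rewrite (eq_deg ip p'S' mT) //; apply: contra mb => p'm.
  by apply/eqP/bP.
(* For [x] on [l], take a line [m] through [p] that is neither [b] nor the line joining [p] to [x].
   It exists because [p] has more than two lines; it misses [x] and has degree [d]. *)
have degp x : x \in pts i -> deg i x = d.
  move=> xS; have [xl|nxl] := boolP (i x l); last by rewrite /d (eq_deg ip xS).
  have px : p != x by apply: contraNneq npl => ->.
  have [a aP] := plane_line ip pS' xS px.
  have [/subsetP sub|/subsetPn[m]] := boolP ([set m | i p m] \subset [set a; b]).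
    have : #|[set m | i p m]| <= 2.
      apply: leq_trans (subset_leq_card (introT subsetP sub)) _.
      by rewrite cards2; case: (a != b).
    by rewrite leqNgt -[#|_|]/(deg i p) -dp (leq_trans _ big) // ltnS; clear -c0; lia.
  rewrite !inE negb_or => pm /andP[ma mb].
  have mT : m \in pts (dual i) by apply: (@mem_pts _ _ (dual i) _ p).
  rewrite -(degl m) // (eq_deg ip xS) //; apply: contra ma => xm.
  by apply/eqP/aP.
have e1 : #|flags i| = #|pts i| * d.
  by rewrite card_flags (eq_bigr _ degp) sum_nat_const.
have e2 : (#|pts (dual i)| - 1) * d <= #|flags i|.
  rewrite -card_flags_dual card_flags.
  apply: (@leq_trans (\sum_(m in pts (dual i) :\ b) deg (dual i) m)).
    rewrite (eq_bigr (fun=> d)) => [|m]; last by rewrite in_setD1 => /andP[mb mT]; apply: degl.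
    rewrite sum_nat_const leq_mul2r; apply/orP; right.
    by rewrite leq_subLR (cardsD1 b (pts _)) leq_add2r leq_b1.
  rewrite [leqRHS](bigID (mem [set~ b])) /= (leq_trans _ (leq_addr _ _)) //.
  by apply/eq_leq/eq_bigl => m; rewrite !in_setD1 !inE andbC.
have s2 : 1 < #|pts i|.
  by apply/card_gt1P; exists p, p'.
have t1 : 0 < #|pts (dual i)| by apply/card_gt0P; exists l.
(* From s d = e, (t - 1) d <= e and e <= c (s + t) follow t <= s + 1 and d <= 3c. *)
exfalso; move: e1 e2 s2 t1 big le_c c0; clearbody d; clear.
move: #|pts i| #|pts (dual i)| #|flags i| => s t e.
by move=> -> e2 s2 t1; nia.
Qed.

(** A long line or, dually, a point of large degree falls under [long_line_flags]. Otherwise all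
    degrees are at most 4c, which leaves at most (4c)^2 points. *)
Lemma plane_flags (P L : finType) (i : P -> L -> bool) c :
  plane i -> 0 < c -> #|flags i| <= c * (#|pts i| + #|pts (dual i)|) ->
  #|flags i| <= 2 * (#|pts i| + #|pts (dual i)|) + (4 * c) ^ 3.
Proof.
move=> ip c0 le_c; have dpl := plane_dual ip.
have [/existsP[l big]|/existsPn small] := boolP [exists l, 4 * c < deg (dual i) l].
  by have := long_line_flags ip c0 le_c big; clear; lia.
have [/existsP[p big]|/existsPn small'] := boolP [exists p, 4 * c < deg i p].
  suff : #|flags i| <= #|pts (dual i)| + 2 * #|pts i| by clear; lia.
  rewrite -card_flags_dual; apply: (long_line_flags dpl c0 _ big).
  by rewrite card_flags_dual addnC.
have [p pS|no] := pickP (mem (pts i)); last first.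
  by rewrite card_flags big1 // => p; have /= -> := no p.
apply: leq_trans (leq_addl _ _); rewrite card_flags.
apply: (@leq_trans (\sum_(p in pts i) 4 * c)).
  by apply: leq_sum => x _; rewrite leqNgt.
rewrite sum_nat_const expnSr leq_mul2r -mulnn (leq_card_pts ip _ _ pS) ?orbT //.
  by move=> l; rewrite leqNgt.
by rewrite leqNgt.
Qed.

(** * Two-colourings without dense monochromatic sets *)

Lemma card_setC (V : finType) (W : {set V}) : #|V| - #|W| = #|~: W|.
Proof. by rewrite [RHS]cardsCs setCK. Qed.

Lemma sum_set_weight (V : finType) D :
  \sum_(W : {set V}) D ^ (#|V| - #|W|) = D.+1 ^ #|V|.
Proof.
transitivity (\prod_(v : V) (1 + D)); last by rewrite prod_nat_const add1n.
rewrite bigA_distr; apply: eq_bigr => W _.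
rewrite card_setC -prod_nat_const big_mkcond /=.
by apply: eq_bigr => v _; rewrite inE; case: (v \in W).
Qed.

(** Union bound over the [W] in question: in a random colouring [Y W] is monochromatic with
    probability at most 2 / 2^#|Y W| <= (1/4) D^(-#|W|), where D = 2^L = 2 #|V|. Over all [W] these
    terms sum to (1/4) (1 + 1/D)^#|V| <= 1/2. *)
Lemma exists_two_colouring (V E : finType) (Y : {set V} -> {set E}) L :
  2 ^ L = 2 * #|V| ->
  exists f : {set E}, forall W : {set V}, L * #|W| + 3 <= #|Y W| ->
    ~~ (Y W \subset f) && ~~ (Y W \subset ~: f).
Proof.
move=> hL; suff /existsP[f /forallP fP] : [exists f : {set E}, [forall W : {set V},
    (L * #|W| + 3 <= #|Y W|) ==> ~~ (Y W \subset f) && ~~ (Y W \subset ~: f)]].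
  by exists f => W; apply/implyP.
apply: contraT => /existsPn many; exfalso.
pose dense (W : {set V}) := L * #|W| + 3 <= #|Y W|.
have cnt (Z : {set E}) : #|[set f : {set E} | Z \subset f]| = 2 ^ (#|E| - #|Z|).
  rewrite card_setC -card_powerset -(card_imset (powerset (~: Z)) (@setC_inj E)).
  apply: eq_card => f; apply/idP/imsetP => [|[g]]; rewrite !inE.
    by move=> Zf; exists (~: f); rewrite ?setCK // inE setCS.
  by move=> gZ ->; rewrite -setCS setCK.
have cnt' (Z : {set E}) : #|[set f : {set E} | Z \subset ~: f]| = 2 ^ (#|E| - #|Z|).
  rewrite card_setC -card_powerset; apply: eq_card => f; rewrite !inE.
  by rewrite -setCS setCK.
have le1 : 2 ^ #|E| <= \sum_(W | dense W) 2 * 2 ^ (#|E| - #|Y W|).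
  rewrite -[X in 2 ^ X <= _]cardsT -card_powerset -sum1_card.
  apply: (@leq_trans (\sum_(f : {set E}) \sum_(W | dense W)
      ((Y W \subset f) + (Y W \subset ~: f)))).
    rewrite [leqRHS](bigID (mem (powerset [set: E]))) /= (leq_trans _ (leq_addr _ _)) //.
    apply: leq_sum => f _; have /forallPn[W] := many f.
    rewrite negb_imply -negb_or negbK => /andP[dW mono].
    rewrite (bigD1 W) //= (leq_trans _ (leq_addr _ _)) //.
    by case/orP: mono => ->; rewrite ?addn1.
  rewrite exchange_big /=; apply: leq_sum => W _; rewrite big_split /=.
  rewrite mul2n -addnn -{1}(cnt (Y W)) -(cnt' (Y W)) -!sum1dep_card.
  by rewrite ![X in _ <= X + _]big_mkcond ![X in _ <= _ + X]big_mkcond leq_add //;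
    apply: leq_sum => f _; case: (_ \subset _).
set D := 2 ^ L in hL *; set h := #|V|.
(* This is [le1] times 8 D^h: for dense [W] the factor 8 D^#|W| is at most 2^#|Y W|. *)
have le2 : 8 * D ^ h * 2 ^ #|E| <= 2 * 2 ^ #|E| * D.+1 ^ h.
  rewrite (leq_trans (leq_mul (leqnn _) le1)) // -[D.+1 ^ h]sum_set_weight !big_distrr /=.
  rewrite [leqRHS](bigID dense) /= (leq_trans _ (leq_addr _ _)) //.
  apply: leq_sum => W dW; rewrite mulnCA -[X in _ <= X]mulnA leq_mul2l /=.
  have -> : D ^ h = D ^ #|W| * D ^ (h - #|W|) by rewrite -expnD subnKC ?max_card.
  rewrite mulnC !mulnA leq_mul2r; apply/orP; right.
  rewrite -[X in _ <= 2 ^ X](subnK (max_card (mem (Y W)))) expnD -mulnA leq_mul2l.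
  apply/orP; right; rewrite -[8]/(2 ^ 3) -expnM -expnD leq_exp2l // addnC.
  exact: dW.
have := leq_trans le2 (leq_mul (leqnn _) (_ : D.+1 ^ h <= 2 * D ^ h)).
have D0 : 0 < D ^ h by rewrite expn_gt0 expn_gt0.
have E0 : 0 < 2 ^ #|E| by rewrite expn_gt0.
rewrite hL -/h expSn_double_le -hL => /(_ isT).
move: D0 E0; move: (D ^ h) (2 ^ #|E|); clear => a b; nia.
Qed.

(** * Incidences of an affine plane *)

Lemma ord2P (j : 'I_2) : j = ord0 \/ j = ord_max.
Proof. by case: j => [[|[|//]] lt]; [left|right]; apply: val_inj. Qed.

Section AffinePlane.
Variable Q : finFieldType.
Implicit Types (w : {ffun 'I_2 -> Q * Q}) (F : {set {ffun 'I_2 -> Q * Q}}).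

(** For (a, b) and (x, y) the equation becomes b + y = a x: the point (x, y) lies on the line of
    slope a and intercept -b. *)
Definition slope_product : {ffun {ffun 'I_2 -> Q} -> Q} :=
  [ffun g : {ffun 'I_2 -> Q} => (g ord0 * g ord_max)%R].

Definition flag_of w := (w ord0, w ord_max).

Lemma flag_of_inj : injective flag_of.
Proof. by move=> w w' [e0 e1]; apply/ffunP => j; case: (ord2P j) => ->. Qed.

Definition ffun2 (u v : Q * Q) : {ffun 'I_2 -> Q * Q} :=
  [ffun j => if j == ord0 then u else v].

Lemma flag_ofK w : ffun2 (w ord0) (w ord_max) = w.
Proof. by apply/ffunP => j; rewrite ffunE; case: (ord2P j) => ->. Qed.

Lemma ffun2_0 u v : ffun2 u v ord0 = u. Proof. by rewrite ffunE. Qed.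
Lemma ffun2_1 u v : ffun2 u v ord_max = v. Proof. by rewrite ffunE. Qed.

Lemma ffun2_shift u v :
  (ffun2 u v \in shift_family slope_product) = (u.2 + v.2 == u.1 * v.1)%R.
Proof. by rewrite inE !big_ord_recl big_ord0 addr0 !ffunE. Qed.

(** The alternating sum of the four equations is (a - a') (x - x') = 0. *)
Lemma affine_lin (u u' v v' : Q * Q) :
  (u.2 + v.2 = u.1 * v.1)%R -> (u.2 + v'.2 = u.1 * v'.1)%R ->
  (u'.2 + v.2 = u'.1 * v.1)%R -> (u'.2 + v'.2 = u'.1 * v'.1)%R ->
  u = u' \/ v = v'.
Proof.
case: u u' v v' => [a b] [a' b'] [x y] [x' y'] /= h1 h2 h3 h4.
have : ((a - a') * (x - x') = 0)%R.
  have -> : ((a - a') * (x - x') = a * x - a * x' - a' * x + a' * x')%R by ring.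
  by rewrite -h1 -h2 -h3 -h4; ring.
move/eqP; rewrite mulf_eq0 !subr_eq0 => /orP[]/eqP e; [left|right]; rewrite -e in h3 h2 h4 *.
  by congr (_, _); apply: (addIr y); rewrite h1 h3.
by congr (_, _); apply: (addrI b); rewrite h1 h2.
Qed.

Section Closed.
Variable F : {set {ffun 'I_2 -> Q * Q}}.
Hypotheses (FA : F \subset shift_family slope_product) (cF : closed_family F).

Let i u v := ffun2 u v \in F.

Lemma closed_flags : #|flags i| = #|F|.
Proof.
rewrite -(card_imset F flag_of_inj); apply: eq_card => -[u v].
apply/idP/imsetP => [|[w wF [-> ->]]]; last by rewrite inE /i flag_ofK.
by rewrite inE => uvF; exists (ffun2 u v); rewrite // /flag_of ffun2_0 ffun2_1.
Qed.

(** For k = 2, edges agreeing off class 0 share their vertex in class 1, which is the joining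
    line. *)
Lemma closed_join p l p' l' : i p l -> i p' l' -> exists2 m, i p m & i p' m.
Proof.
move=> pl p'l'; have [v [v' [vF v'F v0 v'0 vv']]] := cF ord0 pl p'l'.
exists (v ord_max); rewrite /i.
  by rewrite -{1}(ffun2_0 p l) -v0 flag_ofK.
by rewrite vv' // -{1}(ffun2_0 p' l') -v'0 flag_ofK.
Qed.

Lemma closed_meet p l p' l' : i p l -> i p' l' -> exists2 x, i x l & i x l'.
Proof.
move=> pl p'l'; have [v [v' [vF v'F v0 v'0 vv']]] := cF ord_max pl p'l'.
exists (v ord0); rewrite /i.
  by rewrite -{1}(ffun2_1 p l) -v0 flag_ofK.
by rewrite vv' // -{1}(ffun2_1 p' l') -v'0 flag_ofK.
Qed.

Lemma affine_lin_shift u u' v v' :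
  ffun2 u v \in shift_family slope_product ->
  ffun2 u v' \in shift_family slope_product ->
  ffun2 u' v \in shift_family slope_product ->
  ffun2 u' v' \in shift_family slope_product -> u = u' \/ v = v'.
Proof. by rewrite !ffun2_shift => /eqP h1 /eqP h2 /eqP h3 /eqP h4; apply: affine_lin. Qed.

Lemma closed_plane : plane i.
Proof.
split; [exact: closed_join | exact: closed_meet | move=> u u' v v'].
by rewrite /i => /(subsetP FA) h1 /(subsetP FA) h2 /(subsetP FA) h3 /(subsetP FA);
  apply: affine_lin_shift.
Qed.

(* A line of the plane that contains two points of [F] is the line joining
   them within [F]; so [F] contains every incidence between its points and its
   lines. *)
Lemma closed_induced u v : u \in pts i -> v \in pts (dual i) ->
  ffun2 u v \in shift_family slope_product -> i u v.
Proof.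
move=> + + uvA; rewrite !inE => /existsP[m um] /existsP[u' u'v].
have [l ul u'l] := closed_join um u'v.
have [||||uu'|vl] := @affine_lin_shift u u' v l; rewrite ?uvA //.
- exact: (subsetP FA) ul.
- exact: (subsetP FA) u'v.
- exact: (subsetP FA) u'l.
- by rewrite uu'.
- by rewrite vl.
Qed.

Lemma card_closed_pts : #|pts i| <= #|Q|.
Proof.
rewrite -(@card_in_imset _ _ (@fst Q Q)) ?max_card // => p p'.
rewrite !inE => /existsP[l pl] /existsP[l' p'l'] e1.
have := closed_shift_transversal FA cF (j := ord0) pl p'l'.
by rewrite !ffun2_0; apply.
Qed.

Lemma card_closed_lines : #|pts (dual i)| <= #|Q|.
Proof.
rewrite -(@card_in_imset _ _ (@fst Q Q)) ?max_card // => p p'.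
rewrite !inE => /existsP[l pl] /existsP[l' p'l'] e1.
have := closed_shift_transversal FA cF (j := ord_max) pl p'l'.
by rewrite !ffun2_1; apply.
Qed.

Lemma closed_flagsE : flags i = [set z : (Q * Q) * (Q * Q) |
  [&& ffun2 z.1 z.2 \in shift_family slope_product,
      z.1 \in pts i & z.2 \in pts (dual i)]].
Proof.
apply/setP => -[u v]; rewrite in_set /= in_set /=; apply/idP/and3P => [uv|[uvA uS vT]].
  split; first exact: (subsetP FA) uv.
    exact: mem_pts uv.
  by apply: (@mem_pts _ _ (dual i) _ u).
exact: closed_induced.
Qed.

End Closed.

(** Absorbs the cube of log q coming from [plane_flags] into a multiple of q = 2^j. *)
Lemma cube_le_exp2 j : (j + 2) ^ 3 <= 16 * 2 ^ j.
Proof.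
elim: j => [|j IHj] //; case: (leqP 2 j) => [j2|]; last by case: j IHj => [|[|]].
rewrite [2 ^ _]expnS mulnCA (leq_trans _ (leq_mul (leqnn 2) IHj)) //.
by rewrite !expnS expn0; clear IHj; nia.
Qed.

(** [A] is the larger colour class of the incidences. A nonempty closed [F] inside it is all of
    [Y W] for the set [W] of its points and lines, so [Y W] is monochromatic and has at most L #|W|
    + 2 elements, which makes [plane_flags] applicable. *)
Lemma exists_subfamily_eq2 j : #|Q| = 2 ^ j ->
  exists2 A : {set {ffun 'I_2 -> Q * Q}}, #|Q| ^ 3 <= 2 * #|A| &
    forall F : {set {ffun 'I_2 -> Q * Q}}, F \subset A -> closed_family F ->
      #|F| <= (16 * 8 ^ 3 + 4) * #|Q|.
Proof.
move=> cQ; pose U := (Q * Q)%type; set A0 := shift_family slope_product.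
pose Y (W : {set U + U}) := [set z : U * U |
  [&& ffun2 z.1 z.2 \in A0, inl z.1 \in W & inr z.2 \in W]].
(* Makes 2^L = 4 q^2, twice the number of points and lines. *)
pose L := 2 * j + 2.
have [|f fP] := @exists_two_colouring _ _ Y L.
  by rewrite card_sum !card_prod cQ -!expnD !addnn -!mul2n -!expnS /L addn2.
have key (f' : {set U * U}) F : (f' = f \/ f' = ~: f) -> F \subset A0 ->
    (forall w, w \in F -> flag_of w \in f') -> closed_family F ->
    #|F| <= (16 * 8 ^ 3 + 4) * #|Q|.
  move=> f'E FA Ff cF; pose i u v := ffun2 u v \in F.
  have ip : plane i := closed_plane FA cF.
  pose W : {set U + U} := [set inl u | u in pts i] :|: [set inr v | v in pts (dual i)].
  have inlW u : (inl u \in W) = (u \in pts i).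
    rewrite in_setU mem_imset; last by move=> ? ? [].
    by rewrite orbC; case: imsetP => // -[].
  have inrW u : (inr u \in W) = (u \in pts (dual i)).
    rewrite in_setU orbC mem_imset; last by move=> ? ? [].
    by rewrite orbC; case: imsetP => // -[].
  have YE : Y W = flags i.
    rewrite (closed_flagsE FA cF); apply/setP => z.
    by rewrite [LHS]in_set [RHS]in_set inlW inrW.
  have WE : #|W| = #|pts i| + #|pts (dual i)|.
    rewrite cardsU !card_imset; try by move=> ? ? [].
    rewrite (_ : _ :&: _ = set0) ?cards0 ?subn0 //.
    by apply/setP => z; rewrite !inE; apply/andP => -[/imsetP[u _ ->] /imsetP[v]].
  have Yf : Y W \subset f'.
    apply/subsetP => -[u v]; rewrite YE inE => /Ff.
    by rewrite /flag_of ffun2_0 ffun2_1.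
  have ltY : #|flags i| < L * #|W| + 3.
    rewrite -YE ltnNge; apply/negP => /fP/andP[n1 n2].
    by case: f'E => f'E; rewrite f'E in Yf; rewrite Yf in n1 n2.
  have [->|[w wF]] := set_0Vmem F; first by rewrite cards0.
  have s1 : 0 < #|pts i|.
    apply/card_gt0P; exists (w ord0); apply: (@mem_pts _ _ i _ (w ord_max)).
    by rewrite /i flag_ofK.
  have := @plane_flags _ _ i (L + 2) ip.
  rewrite closed_flags // in ltY *; rewrite -WE => plf.
  have {plf} : #|F| <= 2 * #|W| + (4 * (L + 2)) ^ 3.
    apply: plf; rewrite ?addn2 //; move: ltY s1; rewrite WE /L; clear.
    by move: #|pts _| #|pts _| #|F| => s t e; nia.
  (* Since #|W| <= 2q, the term 2 #|W| gives the constant 4; the rest comes from (8 (j + 2))^3 <=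
     8^3 * 16 q. *)
  have := card_closed_pts FA cF; have := card_closed_lines FA cF.
  have := cube_le_exp2 j; rewrite -cQ.
  have -> : 4 * (L + 2) = 8 * (j + 2) by rewrite /L; clear; lia.
  rewrite expnMn WE; clear; move: #|pts _| #|pts _| #|F| #|Q| ((j + 2) ^ 3).
  by move: (8 ^ 3) => a s t e q c; nia.
have cA0 : #|Q| ^ 3 <= #|A0|.
  have := @card_shift_family 2 Q slope_product isT.
  by rewrite -[2 * 2]/4 [X in X <= _]expnSr leq_pmul2r // cQ expn_gt0.
pose B := [set w : {ffun 'I_2 -> Q * Q} | flag_of w \in f].
have := cardsID B A0.
have [le|/ltnW le] := leqP #|A0 :\: B| #|A0 :&: B| => eqA.
  exists (A0 :&: B); first by rewrite (leq_trans cA0) // -eqA mul2n -addnn leq_add2l.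
  move=> F /subsetP FB cF; apply: (key f) => //; first by left.
    by apply/subsetP => w /FB; rewrite inE => /andP[].
  by move=> w /FB; rewrite !inE => /andP[].
exists (A0 :\: B); first by rewrite (leq_trans cA0) // -eqA mul2n -addnn leq_add2r.
move=> F /subsetP FB cF; apply: (key (~: f)) => //; first by right.
  by apply/subsetP => w /FB; rewrite inE => /andP[].
by move=> w /FB; rewrite !inE => /andP[].
Qed.

End AffinePlane.

Lemma exists_base_family k : 1 < k -> exists2 K, 0 < K & forall j, 0 < j ->
  exists (U : finType) (A : {set {ffun 'I_k -> U}}),
    [/\ #|U| = (2 ^ j) ^ 2, (2 ^ j) ^ (2 * k - 1) <= 2 * #|A|
      & forall F : {set {ffun 'I_k -> U}}, F \subset A -> closed_family F ->
        #|F| <= K * (2 ^ j) ^ (k - 1)].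
Proof.
move=> k1.
have field2 j : 0 < j -> exists Q : finFieldType, #|Q| = 2 ^ j.
  by move=> j0; have [Q _ cQ] := pPrimePowerField (isT : prime 2) j0; exists Q.
move: k1; rewrite leq_eqVlt => /orP[/eqP <-|k3].
  exists (16 * 8 ^ 3 + 4) => // j /field2[Q cQ]; have [A cA AP] := exists_subfamily_eq2 cQ.
  by exists (Q * Q)%type, A; rewrite card_prod -cQ mulnn; split.
exists (k + 2) => [|j j0]; first by rewrite addn2.
have [Q cQ] := field2 j j0.
have [||c cP] := @exists_shift_family_ge3 k Q (2 ^ j.-1) k3.
- by rewrite expn_gt0.
- by rewrite -expnS prednK.
have k0 : 0 < k by rewrite ltnW // ltnW.
exists (Q * Q)%type, (shift_family c); rewrite card_prod -cQ mulnn; split=> //.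
have := card_shift_family c k0.
have -> : 2 * k = (2 * k - 1).+1 by move: k0; clear; lia.
rewrite [X in X <= _]expnSr leq_pmul2r ?subn1 => [|]; last by rewrite cQ expn_gt0.
by move=> le; rewrite (leq_trans le) // leq_pmull.
Qed.

(** * Blow-up and conclusion *)

Section BlowUp.
Variables (k : nat) (U T : finType).

Definition proj (w : {ffun 'I_k -> U * T}) : {ffun 'I_k -> U} := [ffun j => (w j).1].

Definition blow_up (A : {set {ffun 'I_k -> U}}) :=
  [set w : {ffun 'I_k -> U * T} | proj w \in A].

Lemma card_blow_up (A : {set {ffun 'I_k -> U}}) : #|A| * #|T| ^ k <= #|blow_up A|.
Proof.
rewrite -[X in _ ^ X]card_ord -card_ffun -cardsT -cardsX.
pose f (z : {ffun 'I_k -> U} * {ffun 'I_k -> T}) : {ffun 'I_k -> U * T} :=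
  [ffun j => (z.1 j, z.2 j)].
have f_inj : injective f.
  move=> [a b] [a' b'] /ffunP e.
  by congr pair; apply/ffunP => j; have := e j; rewrite !ffunE => -[].
rewrite -(card_imset _ f_inj); apply: subset_leq_card.
apply/subsetP => _ /imsetP[[a b] + ->]; rewrite !inE /= andbT.
by congr (_ \in A); apply/ffunP => j; rewrite !ffunE.
Qed.

(** [F] lies in the blow-up of its projection. *)
Lemma card_proj (F : {set {ffun 'I_k -> U * T}}) : #|F| <= #|proj @: F| * #|T| ^ k.
Proof.
rewrite -[X in _ ^ X]card_ord -card_ffun -cardsT -cardsX.
pose f (w : {ffun 'I_k -> U * T}) : {ffun 'I_k -> U} * {ffun 'I_k -> T} :=
  (proj w, [ffun j => (w j).2]).
have f_inj : injective f.
  move=> w w' [/ffunP e1 /ffunP e2]; apply/ffunP => j.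
  have := e1 j; have := e2 j; rewrite !ffunE.
  by case: (w j) (w' j) => [a b] [a' b'] /= -> ->.
rewrite -(card_imset _ f_inj); apply: subset_leq_card.
by apply/subsetP => _ /imsetP[w wF ->]; rewrite !inE andbT /= imset_f.
Qed.

Lemma closed_proj (F : {set {ffun 'I_k -> U * T}}) :
  closed_family F -> closed_family (proj @: F).
Proof.
move=> cF _ _ j /imsetP[w wF ->] /imsetP[w' w'F ->].
have [v [v' [vF v'F vj v'j vv']]] := cF w w' j wF w'F.
exists (proj v), (proj v'); split; rewrite ?imset_f ?ffunE ?vj ?v'j //.
by move=> i /vv' e; rewrite !ffunE e.
Qed.

End BlowUp.

Lemma exists_blown_up_hypergraph (R : realType) (k n b K : nat) (U : finType)
    (A : {set {ffun 'I_k -> U}}) : 1 < k -> k * (#|U| * b) <= n ->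
  (forall F : {set {ffun 'I_k -> U}}, F \subset A -> closed_family F -> #|F| <= K) ->
  exists E : {set {set 'I_n}}, [/\ uniform k E, #|A| * b ^ k <= #|E|
    & forall F : {set {set 'I_n}}, F \subset E -> (diam R k F <= 3%:R%:E)%E ->
        #|F| <= K * b ^ k].
Proof.
move=> k1 len AK.
have len' : #|{: 'I_k * (U * 'I_b)}| <= n by rewrite !card_prod !card_ord.
(* The k #|U| b vertices of the blow-up occupy an initial segment of ['I_n]; the others stay
   isolated. *)
pose io (x : 'I_k * (U * 'I_b)) : 'I_n := widen_ord len' (enum_rank x).
have io_inj : injective io.
  by move=> x y /(congr1 val)/= /val_inj/enum_rank_inj.
set AB := blow_up 'I_b A.
exists (edge io @: AB); split.
- by move=> _ /imsetP[w _ ->]; apply: card_edge.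
- rewrite card_imset; last exact: edge_inj.
  by have := card_blow_up 'I_b A; rewrite card_ord.
move=> F FE /diam_leP dF.
have cF := diam3_closed io_inj k1 FE dF; set F' := [set w in AB | _] in cF.
have -> : #|F| = #|F'|.
  rewrite -(card_imset _ (edge_inj io_inj)); apply: eq_card => e.
  apply/idP/imsetP => [eF|[w]]; last by rewrite inE => /andP[_ wF ->].
  by have /imsetP[w wAB ew] := subsetP FE _ eF; exists w => //; rewrite inE wAB -ew.
apply: leq_trans (card_proj F') _; rewrite card_ord leq_mul2r AK ?orbT //.
  by apply/subsetP => _ /imsetP[w + ->]; rewrite !inE => /andP[].
exact: closed_proj.
Qed.

Local Open Scope ring_scope.

Lemma decomposition_card (R : realType) (V : finType) (k d l M : nat) (eps : R)
    (E : {set {set V}}) (F : 'I_l.+1 -> {set {set V}}) :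
  decomposition k eps d E F ->
  (forall D : {set {set V}}, D \subset E -> (diam R k D <= d%:R%:E)%E -> (#|D| <= M)%N) ->
  #|E|%:R <= eps * #|V|%:R ^+ k + (l * M)%:R.
Proof.
move=> [FE _ F0 Fd] EM.
have FsE i : F i \subset E by rewrite -FE (bigcup_sup i).
have leE : (#|E| <= \sum_i #|F i|)%N.
  rewrite -FE; elim/big_rec2: _ => [|i y s _ le]; first by rewrite cards0.
  by apply: leq_trans (leq_card_setU _ _) _; rewrite leq_add2l.
have leF : (\sum_i #|F i| <= #|F ord0| + l * M)%N.
  rewrite big_ord_recl leq_add2l -[l in (_ <= l * _)%N](card_ord l) -sum_nat_const.
  by apply: leq_sum => i _; apply: EM => //; apply: Fd.
apply: le_trans (_ : (#|F ord0| + l * M)%:R <= _).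
  by rewrite ler_nat (leq_trans leE).
by rewrite natrD lerD2r.
Qed.

Lemma exists_dyadic (R : realType) (y : R) : 2 <= y ->
  exists2 j, (0 < j)%N & (2 ^ j)%:R <= y < 2 * (2 ^ j)%:R.
Proof.
move=> y2; have y0 : 0 <= y by apply: le_trans y2.
have /andP[ty yt] := Num.Theory.truncn_itv y0.
have t2 : (2 <= Num.truncn y)%N by rewrite Num.Theory.truncn_ge_nat.
have /andP[jt tj] := trunc_log_bounds (isT : (1 < 2)%N) (ltnW t2).
exists (trunc_log 2 (Num.truncn y)).
  by rewrite trunc_log_gt0.
rewrite (le_trans _ ty) ?ler_nat //= (lt_le_trans yt) //.
by rewrite -natrM -expnS ler_nat.
Qed.

Theorem theorem4p3 (R : realType) (k : nat) (hk : (2 <= k)%N) :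
  exists c C C' : R,
    [/\ 0 < c, 0 < C, 0 < C'
      & forall (n : nat) (eps : R), (0 < n)%N ->
          C' * (Num.sqrt n%:R)^-1 <= eps -> eps <= C ->
          c * eps ^- k <= (P k n eps 3)%:R].
Proof.
have [K K0 base] := exists_base_family hk.
have k0 : (0 < k)%N by apply: ltnW.
(* [m] is the loss in n^k <= m (b q^2)^k caused by rounding in the blow-up, and [delta] is chosen so
   that at most half of the edges can be discarded. *)
pose m : R := (2 * k)%:R ^+ k.
have m1 : 1 <= m by rewrite exprn_ege1 // ler1n muln_gt0.
have m0 : 0 < m by apply: lt_le_trans m1.
pose delta : R := (4 * m)^-1.
have d0 : 0 < delta by rewrite invr_gt0 mulr_gt0.
have d1 : delta <= 1.
  rewrite invf_le1 ?mulr_gt0 //; apply: le_trans m1 _.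
  by rewrite ler_peMl ?ler1n // ltW.
have K0' : 0 < K%:R :> R by rewrite ltr0n.
(* C = delta / 2 gives delta / eps >= 2, so that a power q >= 2 of two fits below it; C' = k gives k
   q^2 <= n; c comes from q > delta / (2 eps) and q^k <= 4 K l. *)
exists ((delta / 2) ^+ k / (4 * K%:R)), (delta / 2), k%:R; split.
- by rewrite divr_gt0 ?exprn_gt0 ?divr_gt0 ?mulr_gt0.
- by rewrite divr_gt0.
- by rewrite ltr0n.
move=> n eps n0 lo hi.
have n0' : 0 < n%:R :> R by rewrite ltr0n.
have s0 : 0 < Num.sqrt n%:R :> R by rewrite sqrtr_gt0.
have e0 : 0 < eps by apply: lt_le_trans lo; rewrite mulr_gt0 ?invr_gt0 ?ltr0n.
have [|j j0 /andP[qy yq]] := @exists_dyadic R (delta / eps).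
  by rewrite ler_pdivlMr // mulrC -ler_pdivlMr.
have [U [A [cU cA AK]]] := base j j0; move: cU cA AK qy yq.
set q := (2 ^ j)%N => cU cA AK qy yq.
have q0 : (0 < q)%N by rewrite expn_gt0.
clearbody q.
have qe : q%:R * eps <= delta by rewrite -ler_pdivlMr.
have kqn : (k * q ^ 2 <= n)%N.
  have h1 : k%:R * q%:R <= Num.sqrt n%:R :> R.
    rewrite -(@ler_pM2r _ eps) // -mulrA.
    apply: (@le_trans _ _ k%:R); last first.
      by rewrite mulrC -ler_pdivrMr.
    by rewrite ler_piMr ?ler0n // (le_trans qe).
  have h2 : (k%:R * q%:R) ^+ 2 <= n%:R :> R.
    by rewrite -[leRHS]sqr_sqrtr ?ler0n // lerXn2r ?nnegrE ?mulr_ge0 // ltW.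
  apply: (@leq_trans ((k * q) ^ 2)%N); last by rewrite -(ler_nat R) natrX natrM.
  by rewrite expnMn leq_mul // -mulnn leq_pmulr.
set b := (n %/ (k * q ^ 2))%N.
have kq0 : (0 < k * q ^ 2)%N by rewrite muln_gt0 k0 expn_gt0 q0.
have b0 : (0 < b)%N by rewrite divn_gt0.
(* As b >= 1, rounding down loses at most a factor 2. *)
have nb : (n <= 2 * b * (k * q ^ 2))%N.
  apply: leq_trans (ltnW (ltn_ceil n kq0)) _; rewrite -/b leq_mul2r; apply/orP; right.
  by rewrite mul2n -addnn -addn1 leq_add2l.
have [|E [uE cE EK]] := @exists_blown_up_hypergraph R k n b _ U A hk _ AK.
  by rewrite cU mulnA mulnC leq_divM.
have [dec _] := P_spec k n (ltW e0) (isT : (0 < 3)%N).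
have [F Fdec] := dec E uE.
have := decomposition_card Fdec EK; rewrite card_ord; set l := P k n eps 3 => leE.
have q0' : 0 < q%:R :> R by rewrite ltr0n.
(* Each part has at most K Z edges, while [E] has at least q^k Z / 2. *)
pose Z : R := q%:R ^+ (k - 1) * b%:R ^+ k.
have Z0 : 0 < Z by rewrite mulr_gt0 ?exprn_gt0 ?ltr0n.
have ek : q%:R ^+ (2 * k - 1) = q%:R ^+ k * q%:R ^+ (k - 1) :> R.
  by rewrite -exprD addnBA // mul2n addnn.
have le1 : q%:R ^+ k * Z <= 2 * #|E|%:R.
  rewrite mulrA -ek -!natrX -!natrM ler_nat.
  by rewrite (leq_trans (leq_mul cA (leqnn _))) // -mulnA leq_mul2l.
have le2 : eps * n%:R ^+ k <= (q%:R ^+ k * Z) / 4.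
  apply: (@le_trans _ _ (eps * (2 * b * (k * q ^ 2))%:R ^+ k)).
    by rewrite ler_pM2l // lerXn2r ?nnegrE ?ler0n // ler_nat.
  have -> : eps * (2 * b * (k * q ^ 2))%:R ^+ k = (q%:R * eps) * m * (q%:R ^+ k * Z).
    have -> : (2 * b * (k * q ^ 2))%:R = (2 * k)%:R * b%:R * q%:R ^+ 2 :> R.
      by rewrite !natrM; ring.
    have e2 : q%:R ^+ (2 * k) = q%:R * (q%:R ^+ k * q%:R ^+ (k - 1)) :> R.
      by rewrite -ek -exprS subn1 prednK // muln_gt0.
    have e3 (x y z : R) : (x * y * z) ^+ k = x ^+ k * y ^+ k * z ^+ k by rewrite !exprMn.
    by rewrite e3 -exprM e2 /m /Z; ring.
  rewrite [leRHS]mulrC ler_pM2r ?mulr_gt0 ?exprn_gt0 ?ltr0n //.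
  have dm : delta * m = 4^-1 by rewrite /delta invfM mulfVK ?gt_eqF.
  by rewrite -dm ler_pM2r.
have lK : (l * (K * q ^ (k - 1) * b ^ k))%:R = l%:R * K%:R * Z :> R.
  by rewrite !natrM !natrX /Z; ring.
(* At most q^k Z / 4 edges are discarded, so the [l] parts must hold at least q^k Z / 4. *)
have le3 : q%:R ^+ k <= l%:R * (4 * K%:R) :> R.
  rewrite -(@ler_pM2r _ Z) //; move: leE le1 le2; rewrite lK.
  have -> : l%:R * (4 * K%:R) * Z = 4 * (l%:R * K%:R * Z) by ring.
  move: (eps * _) (q%:R ^+ k * Z) (l%:R * _ * Z) => a x y; lra.
rewrite mulrAC -exprVn -exprMn ler_pdivrMr ?mulr_gt0 //.
have le4 : delta / 2 * eps^-1 <= q%:R.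
  by rewrite mulrAC ler_pdivrMr // [leRHS]mulrC ltW.
apply: le_trans le3; rewrite lerXn2r ?nnegrE ?ler0n //.
by apply: ltW; rewrite !divr_gt0.
Qed.
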